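(* Let $k$ be a field. Each dialgebra over $k$ has a bar unit extension; that is, for every dialgebra $D$ over $k$ there exist a dialgebra $D_1$ over $k$ possessing a bar unit and an injective dialgebra homomorphism $D\to D_1$.
   Context: A dialgebra over a field $k$ is a $k$-vector space $D$ with two bilinear associative products $\vdash,\dashv$ such that $a\dashv(b\vdash c)=a\dashv b\dashv c$, $(a\dashv b)\vdash c=a\vdash b\vdash c$, $a\vdash(b\dashv c)=(a\vdash b)\dashv c$ for all $a,b,c\in D$. A dialgebra homomorphism is a $k$-linear map preserving both products. An element $e\in D$ is a bar unit of $D$ if $e\vdash x=x\dashv e=x$ for all $x\in D$. *)

(* Defs.v *)
From HB Require Import structures.
From mathcomp Require Import all_boot all_algebra.

Set Implicit Arguments.
Unset Strict Implicit.
Unset Printing Implicit Defensive.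

Import GRing.Theory.
Local Open Scope ring_scope.

Reserved Notation "x \vdash y" (at level 40, left associativity).
Reserved Notation "x \dashv y" (at level 40, left associativity).

HB.mixin Record Lmodule_isDialgebra (k : fieldType) D of GRing.Lmodule k D := {
  vdash : D -> D -> D;
  dashv : D -> D -> D;
  vdash_bilinear : bilinear_for *:%R *:%R vdash;
  dashv_bilinear : bilinear_for *:%R *:%R dashv;
  vdashA : associative vdash;
  dashvA : associative dashv;
  dashv_vdash : forall a b c : D, dashv a (vdash b c) = dashv (dashv a b) c;
  vdash_dashvl : forall a b c : D, vdash (dashv a b) c = vdash (vdash a b) c;
  vdash_dashvA : forall a b c : D, vdash a (dashv b c) = dashv (vdash a b) c
}.

#[short(type="dialgType")]
HB.structure Definition Dialgebra (k : fieldType) :=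
  {D of GRing.Lmodule k D & Lmodule_isDialgebra k D}.

Notation "x \vdash y" := (vdash x y) : ring_scope.
Notation "x \dashv y" := (dashv x y) : ring_scope.

Definition bar_unit (k : fieldType) (D : dialgType k) (e : D) : Prop :=
  forall x : D, e \vdash x = x /\ x \dashv e = x.

(* Linearity is not part of this predicate: a dialgebra homomorphism is a
   map of type {linear D -> D'} satisfying it. *)
Definition dialg_multiplicative (k : fieldType) (D D' : dialgType k)
    (f : D -> D') : Prop :=
  {morph f : x y / x \vdash y} /\ {morph f : x y / x \dashv y}.

(* Main.v *)
(** Let [A] be the associative algebra of pairs [(a |- _ + s, _ -| a + s)] of
    operators on [D].  It is unital, it acts on [D] from both sides, and
    [a |-> (a |- _, _ -| a)] is a bimodule map from [D] to [A]; the operators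
    identify [a |- b] with [a -| b], as is forced on the images of the products.
    Hence [D + A] is an [A]-bimodule with a bimodule map [F] onto [A], and
    [x |- y := F x * y], [x -| y := x * F y] make it a dialgebra containing [D].
    The unit of [A] is a bar unit because [F 1 = 1]. *)

Require Import Defs.
From HB Require Import structures.
From mathcomp Require Import all_boot all_algebra.
From mathcomp Require Import boolp functions.

Set Implicit Arguments.
Unset Strict Implicit.
Unset Printing Implicit Defensive.

Import GRing.Theory.
Local Open Scope ring_scope.

(** * Linearity of the products in each argument *)

Lemma vdashPl (k : fieldType) (D : dialgType k) (y : D) :
  linear (fun x : D => x \vdash y).
Proof. by case: (@vdash_bilinear k D). Qed.

Lemma vdashPr (k : fieldType) (D : dialgType k) (x : D) :
  linear (fun y : D => x \vdash y).
Proof. by case: (@vdash_bilinear k D). Qed.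

Lemma dashvPl (k : fieldType) (D : dialgType k) (y : D) :
  linear (fun x : D => x \dashv y).
Proof. by case: (@dashv_bilinear k D). Qed.

Lemma dashvPr (k : fieldType) (D : dialgType k) (x : D) :
  linear (fun y : D => x \dashv y).
Proof. by case: (@dashv_bilinear k D). Qed.

HB.instance Definition _ (k : fieldType) (D : dialgType k) (x : D) :=
  GRing.isLinear.Build k D D *:%R (vdash x) (@vdashPr k D x).

HB.instance Definition _ (k : fieldType) (D : dialgType k) (x : D) :=
  GRing.isLinear.Build k D D *:%R (dashv x) (@dashvPr k D x).

Lemma vdash0l (k : fieldType) (D : dialgType k) (y : D) : 0 \vdash y = 0.
(* At the scalar -1 and two zero vectors, the right side of linearity cancels. *)
Proof. by have := vdashPl y (-1) 0 0; rewrite addr0 scaler0 scaleN1r addNr. Qed.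

Lemma dashv0l (k : fieldType) (D : dialgType k) (y : D) : 0 \dashv y = 0.
Proof. by have := dashvPl y (-1) 0 0; rewrite addr0 scaler0 scaleN1r addNr. Qed.

Lemma vdashDl (k : fieldType) (D : dialgType k) (a b z : D) :
  (a + b) \vdash z = a \vdash z + b \vdash z.
Proof. by have := vdashPl z 1 a b; rewrite !scale1r. Qed.

Lemma vdashZl (k : fieldType) (D : dialgType k) (c : k) (a z : D) :
  (c *: a) \vdash z = c *: (a \vdash z).
Proof. by have := vdashPl z c a 0; rewrite vdash0l !addr0. Qed.

Lemma dashvDl (k : fieldType) (D : dialgType k) (a b z : D) :
  (a + b) \dashv z = a \dashv z + b \dashv z.
Proof. by have := dashvPl z 1 a b; rewrite !scale1r. Qed.

Lemma dashvZl (k : fieldType) (D : dialgType k) (c : k) (a z : D) :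
  (c *: a) \dashv z = c *: (a \dashv z).
Proof. by have := dashvPl z c a 0; rewrite dashv0l !addr0. Qed.

(** * Left and right operators of the formal sums [a + s] *)

Definition lmul (k : fieldType) (D : dialgType k) (a : D) (s : k) : D -> D :=
  fun z => a \vdash z + s *: z.

Definition rmul (k : fieldType) (D : dialgType k) (a : D) (s : k) : D -> D :=
  fun z => z \dashv a + s *: z.

Lemma lmul_linear (k : fieldType) (D : dialgType k) (a : D) (s : k) :
  linear (lmul a s).
Proof.
by move=> c x y; rewrite /lmul linearP !scalerDr !scalerA (mulrC s) addrACA.
Qed.

Lemma rmul_linear (k : fieldType) (D : dialgType k) (a : D) (s : k) :
  linear (rmul a s).
Proof.
by move=> c x y; rewrite /rmul dashvPl !scalerDr !scalerA (mulrC s) addrACA.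
Qed.

HB.instance Definition _ (k : fieldType) (D : dialgType k) (a : D) (s : k) :=
  GRing.isLinear.Build k D D *:%R (lmul a s) (lmul_linear a s).

HB.instance Definition _ (k : fieldType) (D : dialgType k) (a : D) (s : k) :=
  GRing.isLinear.Build k D D *:%R (rmul a s) (rmul_linear a s).

Lemma lmulP (k : fieldType) (D : dialgType k) (c : k) (a b : D) (s t : k) :
  c *: lmul a s + lmul b t = lmul (c *: a + b) (c * s + t).
Proof.
apply/funext => z; rewrite /lmul vdashPl scalerDl -scalerA addrACA -scalerDr.
by [].
Qed.

Lemma rmulP (k : fieldType) (D : dialgType k) (c : k) (a b : D) (s t : k) :
  c *: rmul a s + rmul b t = rmul (c *: a + b) (c * s + t).
Proof.
apply/funext => z; rewrite /rmul dashvPr scalerDl -scalerA addrACA -scalerDr.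
by [].
Qed.

(** The parameters multiply as in the unitization of [(D, |-)]: [(a + s)(b + t) = (a |- b + s b + t
    a) + s t]. *)
Lemma lmul_comp (k : fieldType) (D : dialgType k) (a b : D) (s t : k) :
  lmul a s \o lmul b t = lmul (lmul a s b + t *: a) (s * t).
Proof.
apply/funext => z; rewrite /= /lmul !vdashDl !vdashZl linearD linearZ /=.
by rewrite vdashA scalerDr scalerA addrACA -!addrA.
Qed.

(** Since [(z -| a) -| b = z -| (a |- b)], the parameters agree with those of [lmul_comp], so
    products of pairs stay in [A]. *)
Lemma rmul_comp (k : fieldType) (D : dialgType k) (a b : D) (s t : k) :
  rmul b t \o rmul a s = rmul (lmul a s b + t *: a) (s * t).
Proof.
apply/funext => z; rewrite /= /lmul /rmul !linearD !linearZ /= dashv_vdash.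
by rewrite dashvDl dashvZl scalerA -!addrA.
Qed.

Lemma lmul_rmul (k : fieldType) (D : dialgType k) (a b : D) (s t : k) (z : D) :
  lmul a s (rmul b t z) = rmul b t (lmul a s z).
Proof.
rewrite /lmul /rmul linearD linearZ /= dashvDl dashvZl !scalerDr !scalerA.
by rewrite vdash_dashvA [t * s]mulrC addrACA.
Qed.

(** First of four identities making [d |-> (d |- _, _ -| d)] a bimodule map: [lmul_lmul] and
    [rmul_lmulr] are the components of left linearity, [rmul_lmull] and [rmul_rmulr] those of right
    linearity. *)
Lemma lmul_lmul (k : fieldType) (D : dialgType k) (a d z : D) (s : k) :
  lmul a s d \vdash z = lmul a s (d \vdash z).
Proof. by rewrite /lmul vdashDl vdashZl vdashA. Qed.

Lemma rmul_lmull (k : fieldType) (D : dialgType k) (a d z : D) (s : k) :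
  rmul a s d \vdash z = d \vdash lmul a s z.
Proof.
by rewrite /lmul /rmul vdashDl vdashZl vdash_dashvl linearD linearZ /= vdashA.
Qed.

Lemma rmul_lmulr (k : fieldType) (D : dialgType k) (a d z : D) (s : k) :
  z \dashv lmul a s d = rmul a s z \dashv d.
Proof. by rewrite /lmul /rmul linearD linearZ /= dashvDl dashvZl dashv_vdash. Qed.

Lemma rmul_rmulr (k : fieldType) (D : dialgType k) (a d z : D) (s : k) :
  z \dashv rmul a s d = rmul a s (z \dashv d).
Proof. by rewrite /rmul linearD linearZ /= dashvA. Qed.

(** * The module [D + A] and its two products *)

(** In [x.2 = (l, r)], [l] acts on [D] from the left and [r] from the right, so
    the product is [(l, r) (l', r') = (l \o l', r' \o r)]. *)
Definition multiplier_ext (k : fieldType) (D : dialgType k) : lmodType k :=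
  (D * ((D -> D) * (D -> D)))%type.

(** The parameters are existential because the operators need not determine them: when both products
    vanish, every [a] gives the same pair. *)
Definition inner_multiplier (k : fieldType) (D : dialgType k) :
    {pred multiplier_ext D} :=
  fun x => `[< exists a s, x.2 = (lmul a s, rmul a s) >].

Arguments inner_multiplier {k} D.

Lemma inner_multiplierP (k : fieldType) (D : dialgType k)
    (x : multiplier_ext D) :
  reflect (exists a s, x.2 = (lmul a s, rmul a s)) (x \in inner_multiplier D).
Proof. exact: asboolP. Qed.

Lemma inner_multiplier_submod (k : fieldType) (D : dialgType k) :
  submod_closed (inner_multiplier D).
Proof.
split=> [|c [d m] [d' m']].
  apply/inner_multiplierP; exists 0, 0; congr pair; apply/funext => z.
    by rewrite /lmul vdash0l scale0r addr0.
  by rewrite /rmul linear0 scale0r addr0.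
move=> /inner_multiplierP[a [s /= ->]] /inner_multiplierP[b [t /= ->]].
apply/inner_multiplierP; exists (c *: a + b), (c * s + t).
by rewrite -lmulP -rmulP.
Qed.

HB.instance Definition _ (k : fieldType) (D : dialgType k) :=
  GRing.isSubmodClosed.Build k (multiplier_ext D) (inner_multiplier D)
    (@inner_multiplier_submod k D).

(** [(lact x, ract x)] is the value [F x] of the bimodule map. *)
Definition lact (k : fieldType) (D : dialgType k) (x : multiplier_ext D) :
  D -> D := fun z => x.1 \vdash z + x.2.1 z.

Definition ract (k : fieldType) (D : dialgType k) (x : multiplier_ext D) :
  D -> D := fun z => z \dashv x.1 + x.2.2 z.

Definition vdash_ext (k : fieldType) (D : dialgType k)
    (x y : multiplier_ext D) : multiplier_ext D :=
  (lact x y.1, (lact x \o y.2.1, y.2.2 \o ract x)).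

Definition dashv_ext (k : fieldType) (D : dialgType k)
    (x y : multiplier_ext D) : multiplier_ext D :=
  (ract y x.1, (x.2.1 \o lact y, ract y \o x.2.2)).


(** * The bimodule map [F] and its multiplicativity *)

(** With [ractE], this shows that [F] takes values in [A], so the identities for [lmul] and [rmul]
    apply to [lact] and [ract]. *)
Lemma lactE (k : fieldType) (D : dialgType k) (x : multiplier_ext D)
    (a : D) (s : k) :
  x.2 = (lmul a s, rmul a s) -> lact x = lmul (x.1 + a) s.
Proof. by move=> xE; apply/funext => z; rewrite /lact xE /lmul vdashDl addrA. Qed.

Lemma ractE (k : fieldType) (D : dialgType k) (x : multiplier_ext D)
    (a : D) (s : k) :
  x.2 = (lmul a s, rmul a s) -> ract x = rmul (x.1 + a) s.
Proof. by move=> xE; apply/funext => z; rewrite /ract xE /rmul linearD addrA. Qed.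

Lemma lactP (k : fieldType) (D : dialgType k) (c : k)
    (x y : multiplier_ext D) :
  lact (c *: x + y) = c *: lact x + lact y.
Proof.
by apply/funext => z; rewrite /lact /= vdashPl addrACA -scalerDr.
Qed.

Lemma ractP (k : fieldType) (D : dialgType k) (c : k)
    (x y : multiplier_ext D) :
  ract (c *: x + y) = c *: ract x + ract y.
Proof.
by apply/funext => z; rewrite /ract /= dashvPr addrACA -scalerDr.
Qed.

(** Left linearity of [F] gives [F (F x * y) = F x * F y]; this is the first component and
    [ract_vdash_ext] the second. *)
Lemma lact_vdash_ext (k : fieldType) (D : dialgType k)
    (x y : multiplier_ext D) :
  x \in inner_multiplier D -> lact (vdash_ext x y) = lact x \o lact y.
Proof.
move=> /inner_multiplierP[a [s xE]]; apply/funext => z.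
by rewrite {1}/lact /= (lactE xE) lmul_lmul -linearD.
Qed.

Lemma ract_vdash_ext (k : fieldType) (D : dialgType k)
    (x y : multiplier_ext D) :
  x \in inner_multiplier D -> ract (vdash_ext x y) = ract y \o ract x.
Proof.
move=> /inner_multiplierP[a [s xE]]; apply/funext => z.
by rewrite {1}/ract /= (lactE xE) (ractE xE) rmul_lmulr.
Qed.

(** Right linearity gives [F (x * F y) = F x * F y], so [F] does not distinguish the two
    products. *)
Lemma lact_dashv_ext (k : fieldType) (D : dialgType k)
    (x y : multiplier_ext D) :
  y \in inner_multiplier D -> lact (dashv_ext x y) = lact x \o lact y.
Proof.
move=> /inner_multiplierP[a [s yE]]; apply/funext => z.
by rewrite {1}/lact /= (lactE yE) (ractE yE) rmul_lmull.
Qed.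

Lemma ract_dashv_ext (k : fieldType) (D : dialgType k)
    (x y : multiplier_ext D) :
  y \in inner_multiplier D -> ract (dashv_ext x y) = ract y \o ract x.
Proof.
move=> /inner_multiplierP[a [s yE]]; apply/funext => z.
by rewrite {1}/ract /= (ractE yE) rmul_rmulr -linearD.
Qed.

Lemma lact_ract (k : fieldType) (D : dialgType k) (x y : multiplier_ext D)
    (z : D) :
  x \in inner_multiplier D -> y \in inner_multiplier D ->
  lact x (ract y z) = ract y (lact x z).
Proof.
move=> /inner_multiplierP[a [s xE]] /inner_multiplierP[b [t yE]].
by rewrite (lactE xE) (ractE yE) lmul_rmul.
Qed.

(** * Closure and bilinearity of the products *)

Lemma vdash_ext_inner (k : fieldType) (D : dialgType k)
    (x y : multiplier_ext D) :
  x \in inner_multiplier D -> y \in inner_multiplier D ->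
  vdash_ext x y \in inner_multiplier D.
Proof.
move=> /inner_multiplierP[a [s xE]] /inner_multiplierP[b [t yE]].
(* Both operators must share their parameters; [lmul_comp] and [rmul_comp] supply the same ones. *)
apply/inner_multiplierP; eexists; eexists.
by rewrite /vdash_ext (lactE xE) (ractE xE) yE /= lmul_comp rmul_comp.
Qed.

Lemma dashv_ext_inner (k : fieldType) (D : dialgType k)
    (x y : multiplier_ext D) :
  x \in inner_multiplier D -> y \in inner_multiplier D ->
  dashv_ext x y \in inner_multiplier D.
Proof.
move=> /inner_multiplierP[a [s xE]] /inner_multiplierP[b [t yE]].
apply/inner_multiplierP; eexists; eexists.
by rewrite /dashv_ext (lactE yE) (ractE yE) xE /= lmul_comp rmul_comp.
Qed.

(** Composition is linear in the inner map when the outer one is linear. Here the outer map [y.2.2]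
    is some [rmul b t], whereas a general element of [multiplier_ext] carries arbitrary
    functions. *)
Lemma vdash_extPl (k : fieldType) (D : dialgType k) (y : multiplier_ext D) :
  y \in inner_multiplier D -> linear (fun x => vdash_ext x y).
Proof.
move=> /inner_multiplierP[b [t yE]] c x x'.
rewrite /vdash_ext lactP ractP yE; congr (_, (_, _)).
by apply/funext => z /=; rewrite linearP.
Qed.

Lemma vdash_extPr (k : fieldType) (D : dialgType k) (x : multiplier_ext D) :
  x \in inner_multiplier D -> linear (vdash_ext x).
Proof.
move=> /inner_multiplierP[a [s xE]] c y y'.
rewrite /vdash_ext (lactE xE); congr (_, (_, _)); first by rewrite linearP.
by apply/funext => z /=; rewrite linearP.
Qed.

Lemma dashv_extPl (k : fieldType) (D : dialgType k) (y : multiplier_ext D) :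
  y \in inner_multiplier D -> linear (fun x => dashv_ext x y).
Proof.
move=> /inner_multiplierP[b [t yE]] c x x'.
rewrite /dashv_ext (ractE yE); congr (_, (_, _)); first by rewrite linearP.
by apply/funext => z /=; rewrite linearP.
Qed.

Lemma dashv_extPr (k : fieldType) (D : dialgType k) (x : multiplier_ext D) :
  x \in inner_multiplier D -> linear (dashv_ext x).
Proof.
move=> /inner_multiplierP[a [s xE]] c y y'.
rewrite /dashv_ext lactP ractP xE; congr (_, (_, _)).
by apply/funext => z /=; rewrite linearP.
Qed.

(** * The dialgebra structure on [D + A] *)

Record bar_ext (k : fieldType) (D : dialgType k) := BarExt {
  bar_ext_val :> multiplier_ext D;
  _ : bar_ext_val \in inner_multiplier D }.

HB.instance Definition _ (k : fieldType) (D : dialgType k) :=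
  [isSub for @bar_ext_val k D].
HB.instance Definition _ (k : fieldType) (D : dialgType k) :=
  [Choice of bar_ext D by <:].
HB.instance Definition _ (k : fieldType) (D : dialgType k) :=
  [SubChoice_isSubLmodule of bar_ext D by <:].

Definition bar_vdash (k : fieldType) (D : dialgType k) (x y : bar_ext D) :=
  BarExt (vdash_ext_inner (valP x) (valP y)).

Definition bar_dashv (k : fieldType) (D : dialgType k) (x y : bar_ext D) :=
  BarExt (dashv_ext_inner (valP x) (valP y)).

Lemma bar_vdash_bilinear (k : fieldType) (D : dialgType k) :
  bilinear_for *:%R *:%R (@bar_vdash k D).
Proof.
split=> x c y y'; apply: val_inj; rewrite linearP.
  exact: (vdash_extPl (valP x)).
exact: (vdash_extPr (valP x)).
Qed.

Lemma bar_dashv_bilinear (k : fieldType) (D : dialgType k) :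
  bilinear_for *:%R *:%R (@bar_dashv k D).
Proof.
split=> x c y y'; apply: val_inj; rewrite linearP.
  exact: (dashv_extPl (valP x)).
exact: (dashv_extPr (valP x)).
Qed.

(** Multiplicativity of [F] reduces this to associativity of the left action. *)
Lemma bar_vdashA (k : fieldType) (D : dialgType k) :
  associative (@bar_vdash k D).
Proof.
move=> x y z; apply: val_inj.
by rewrite /= {1 3}/vdash_ext lact_vdash_ext ?ract_vdash_ext ?(valP x).
Qed.

Lemma bar_dashvA (k : fieldType) (D : dialgType k) :
  associative (@bar_dashv k D).
Proof.
move=> x y z; apply: val_inj.
by rewrite /= {1 3}/dashv_ext lact_dashv_ext ?ract_dashv_ext ?(valP z).
Qed.

Lemma bar_dashv_vdash (k : fieldType) (D : dialgType k) (x y z : bar_ext D) :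
  bar_dashv x (bar_vdash y z) = bar_dashv (bar_dashv x y) z.
Proof.
apply: val_inj.
by rewrite /= {1 2}/dashv_ext lact_vdash_ext ?ract_vdash_ext ?(valP y).
Qed.

(** The left factors have the same image [F x * F y]. *)
Lemma bar_vdash_dashvl (k : fieldType) (D : dialgType k) (x y z : bar_ext D) :
  bar_vdash (bar_dashv x y) z = bar_vdash (bar_vdash x y) z.
Proof.
apply: val_inj; rewrite /= {1 2}/vdash_ext lact_vdash_ext ?(valP x) //.
by rewrite ract_vdash_ext ?(valP x) // lact_dashv_ext ?ract_dashv_ext ?(valP y).
Qed.

(** The two actions commute: by [lact_ract] on [D], by associativity of composition on [A]. *)
Lemma bar_vdash_dashvA (k : fieldType) (D : dialgType k) (x y z : bar_ext D) :
  bar_vdash x (bar_dashv y z) = bar_dashv (bar_vdash x y) z.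
Proof.
apply: val_inj; rewrite /= /vdash_ext /dashv_ext /=.
by rewrite lact_ract ?(valP x) ?(valP z).
Qed.

HB.instance Definition _ (k : fieldType) (D : dialgType k) :=
  Lmodule_isDialgebra.Build k (bar_ext D) (@bar_vdash_bilinear k D)
    (@bar_dashv_bilinear k D) (@bar_vdashA k D) (@bar_dashvA k D)
    (@bar_dashv_vdash k D) (@bar_vdash_dashvl k D) (@bar_vdash_dashvA k D).

(** * The bar unit and the embedding *)

Lemma lact_one (k : fieldType) (D : dialgType k) :
  lact ((0, (id, id)) : multiplier_ext D) = id.
Proof. by apply/funext => z; rewrite /lact /= vdash0l add0r. Qed.

Lemma ract_one (k : fieldType) (D : dialgType k) :
  ract ((0, (id, id)) : multiplier_ext D) = id.
Proof. by apply/funext => z; rewrite /ract /= linear0 add0r. Qed.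

Lemma lact_embed (k : fieldType) (D : dialgType k) (d : D) :
  lact ((d, 0) : multiplier_ext D) = vdash d.
Proof. by apply/funext => z; rewrite /lact /= addr0. Qed.

Lemma ract_embed (k : fieldType) (D : dialgType k) (d : D) :
  ract ((d, 0) : multiplier_ext D) = dashv^~ d.
Proof. by apply/funext => z; rewrite /ract /= addr0. Qed.

Lemma bar_ext_one_inner (k : fieldType) (D : dialgType k) :
  ((0, (id, id)) : multiplier_ext D) \in inner_multiplier D.
Proof.
apply/inner_multiplierP; exists 0, 1; congr pair; apply/funext => z.
  by rewrite /lmul vdash0l scale1r add0r.
by rewrite /rmul linear0 scale1r add0r.
Qed.

Lemma bar_ext_embed_inner (k : fieldType) (D : dialgType k) (d : D) :
  ((d, 0) : multiplier_ext D) \in inner_multiplier D.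
Proof.
apply/inner_multiplierP; exists 0, 0; congr pair; apply/funext => z.
  by rewrite /lmul vdash0l scale0r add0r.
by rewrite /rmul linear0 scale0r add0r.
Qed.

Definition bar_ext_embed (k : fieldType) (D : dialgType k) (d : D) :=
  BarExt (bar_ext_embed_inner d).

Lemma bar_ext_embed_linear (k : fieldType) (D : dialgType k) :
  linear (@bar_ext_embed k D).
Proof.
by move=> c d d'; apply: val_inj; rewrite linearP; congr pair;
  rewrite /= scaler0 addr0.
Qed.

HB.instance Definition _ (k : fieldType) (D : dialgType k) :=
  GRing.isLinear.Build k D (bar_ext D) *:%R (@bar_ext_embed k D)
    (@bar_ext_embed_linear k D).

Theorem theorem4p6 (k : fieldType) (D : dialgType k) :
  exists D1 : dialgType k,
    (exists e : D1, bar_unit e) /\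
    (exists f : {linear D -> D1}, dialg_multiplicative f /\ injective f).
Proof.
exists (bar_ext D); split.
  (* The unit of [A], with zero [D] component, is fixed by [F] and therefore acts as the
     identity. *)
  exists (BarExt (bar_ext_one_inner D)) => -[[d [l r]] xP].
  by split; apply: val_inj;
    rewrite /= /vdash_ext /dashv_ext lact_one ract_one.
exists (@bar_ext_embed k D); split; last by move=> d d' [].
split=> d d'; apply: val_inj.
  rewrite /= /vdash_ext lact_embed; congr (_, (_, _)).
  (* Embedded elements have zero operators, and [d |- 0 = 0] keeps the product so. *)
  by apply/funext => z /=; rewrite linear0.
rewrite /= /dashv_ext ract_embed; congr (_, (_, _)).
by apply/funext => z /=; rewrite dashv0l.
Qed.
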